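(* Let $v(\cdot)$ denote the optimal value of a minimization problem (the infimum, with value $+\infty$ if the problem is infeasible). For the problem (P) and its relaxations $(\mathrm{SDP})$, $(\mathrm{SDP_{RLT}})$, $(\mathrm{SDP_{SOC\text{-}RLT}})$, $(\mathrm{SDP_{GSRT\text{-}A}})$ defined in the context, $$v(\mathrm{P})\ \ge\ v(\mathrm{SDP_{GSRT\text{-}A}})\ \ge\ v(\mathrm{SDP_{SOC\text{-}RLT}})\ \ge\ v(\mathrm{SDP_{RLT}})\ \ge\ v(\mathrm{SDP}).$$
   Context: Data: $Q_0,\dots,Q_l$ real symmetric $n\times n$ matrices ($Q_i\ne 0$ for $i\ge 1$), $c_0,\dots,c_l\in\mathbb{R}^n$, $d_1,\dots,d_l\in\mathbb{R}$, $a_1,\dots,a_m\in\mathbb{R}^n$, $b_1,\dots,b_m\in\mathbb{R}$. Problem (P): minimize $x^TQ_0x+c_0^Tx$ over $x\in\mathbb{R}^n$ subject to $x^TQ_ix+c_i^Tx+d_i\le 0$ ($i=1,\dots,l$) and $a_j^Tx\le b_j$ ($j=1,\dots,m$). Let $\mathcal{C}=\{i\in\{1,\dots,l\}: Q_i\succeq 0\}$ and $\mathcal{N}=\{1,\dots,l\}\setminus\mathcal{C}$, with $k=|\mathcal{C}|$. For $i\in\mathcal{C}$ fix a matrix $B_i\in\mathbb{R}^{n\times n}$ with $Q_i=B_i^TB_i$. For $i\in\mathcal{N}$ write $Q_i=L_i^TL_i-M_i^TM_i$, where, from a spectral decomposition of $Q_i$, the rows of $L_i$ are $\sqrt{\lambda}\,v^T$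 over the positive eigenvalues $\lambda$ (with orthonormal eigenvectors $v$) and the rows of $M_i$ are $\sqrt{-\lambda}\,v^T$ over the negative eigenvalues. $A\cdot B=\sum_{i,j}A_{ij}B_{ij}$ and $\|\cdot\|$ is the Euclidean norm. The relaxations have a variable $x\in\mathbb{R}^n$ and a symmetric $n\times n$ matrix variable $X$, and objective: minimize $Q_0\cdot X+c_0^Tx$. $(\mathrm{SDP})$ has the constraints: (1) $Q_i\cdot X+c_i^Tx+d_i\le0$, $i=1,\dots,l$; (2) $a_j^Tx\le b_j$, $j=1,\dots,m$; (3) $\begin{pmatrix}1&x^T\\ x&X\end{pmatrix}\succeq0$. $(\mathrm{SDP_{RLT}})$ has the constraints (1), (2), (3) and: (4) $a_ia_j^T\cdot X+b_ib_j-b_ja_i^Tx-b_ia_j^Tx\ge0$ for all $1\le i<j\le m$. $(\mathrm{SDP_{SOC\text{-}RLT}})$ has the constraints (1)-(4) and: (5) for all $i\in\mathcal{C}$, $j=1,\dots,m$, $$\left\|\begin{pmatrix}B_i(b_jx-Xa_j)\\ \tfrac12\left(-c_i^TXa_j+(b_jc_i^T-d_ia_j^T-a_j^T)x+(1+d_i)b_j\right)\end{pmatrix}\right\|\le\tfrac12\left(c_i^TXa_j+(d_ia_j^T-a_j^T-b_jc_i^T)x+(1-d_i)b_j\right).$$ $(\mathrm{SDP_{GSRT\text{-}A}})$ has additional variables $z\in\mathbb{R}^{\mathcal{N}}$, $S\in\mathbb{R}^{n\times\mathcal{N}}$ and a symmetric $Z\in\mathbb{R}^{\mathcal{N}\times\mathcal{N}}$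 ($S_{\cdot,i}$ is the column of $S$ indexed by $i$), and the constraints (1), (2), (4), (5) together with, for all $i\in\mathcal{N}$ and $j=1,\dots,m$, $$\left\|\begin{pmatrix}L_ix\\ \tfrac12(c_i^Tx+d_i+1)\end{pmatrix}\right\|\le z_i,\qquad \left\|\begin{pmatrix}M_ix\\ \tfrac12(c_i^Tx+d_i-1)\end{pmatrix}\right\|\le z_i,$$ $$\left\|\begin{pmatrix}L_i(b_jx-Xa_j)\\ \tfrac12\left(c_i^T(b_jx-Xa_j)+(d_i+1)(b_j-a_j^Tx)\right)\end{pmatrix}\right\|\le z_ib_j-S_{\cdot,i}^Ta_j,$$ $$\left\|\begin{pmatrix}M_i(b_jx-Xa_j)\\ \tfrac12\left(c_i^T(b_jx-Xa_j)+(d_i-1)(b_j-a_j^Tx)\right)\end{pmatrix}\right\|\le z_ib_j-S_{\cdot,i}^Ta_j,$$ $$Z_{i,i}=X\cdot M_i^TM_i+\tfrac14\left(c_ic_i^T\cdot X+(d_i-1)^2+2(d_i-1)c_i^Tx\right),$$ and $\begin{pmatrix}1&x^T&z^T\\ x&X&S\\ z&S^T&Z\end{pmatrix}\succeq0$. *)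

(* Defs.v *)
From mathcomp Require Import all_boot all_order all_algebra.
From mathcomp Require Import all_classical all_reals ereal.

Set Implicit Arguments.
Unset Strict Implicit.
Unset Printing Implicit Defensive.

Import Order.TTheory GRing.Theory Num.Theory.
Local Open Scope ring_scope.

Definition dotv (R : realType) (n : nat) (u v : 'cV[R]_n) : R :=
  \sum_(i < n) u i 0 * v i 0.

Definition dotm (R : realType) (n : nat) (A B : 'M[R]_n) : R :=
  \sum_(i < n) \sum_(j < n) A i j * B i j.

(* The norm `|u| of the library on matrices is the max norm. *)
Definition norm2 (R : realType) (n : nat) (u : 'cV[R]_n) : R :=
  Num.sqrt (\sum_(i < n) u i 0 ^+ 2).

(* Euclidean norm of the vector u extended by one last entry s. *)
Definition norm2_app (R : realType) (n : nat) (u : 'cV[R]_n) (s : R) : R :=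
  norm2 (col_mx u (s%:M : 'cV[R]_1)).

Definition psd (R : realType) (n : nat) (A : 'M[R]_n) : Prop :=
  A^T = A /\ forall u : 'cV[R]_n, 0 <= dotv u (A *m u).

Definition optval (R : realType) (T : Type) (F : set T) (f : T -> R) : \bar R :=
  ereal_inf [set (f t)%:E | t in F]%classic.

Record qcqp (R : realType) (n l m : nat) := Qcqp {
  Q0 : 'M[R]_n;
  c0 : 'cV[R]_n;
  Q : 'I_l -> 'M[R]_n;
  c : 'I_l -> 'cV[R]_n;
  d : 'I_l -> R;
  a : 'I_m -> 'cV[R]_n;
  b : 'I_m -> R
}.

Definition cvx_idx (R : realType) (n l m : nat) (P : qcqp R n l m) :
  {set 'I_l} := finset (fun i : 'I_l => `[< psd (Q P i) >]).

Definition ncvx_idx (R : realType) (n l m : nat) (P : qcqp R n l m) :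
  {set 'I_l} := (~: cvx_idx P)%SET.

(* The columns of V are orthonormal eigenvectors of A, and lam 0 k is the
   eigenvalue of column k. *)
Definition spectral_decomposition (R : realType) (n : nat) (A V : 'M[R]_n)
  (lam : 'rV[R]_n) : Prop :=
  V^T *m V = 1%:M /\ A = V *m diag_mx lam *m V^T.

Definition pos_idx (R : realType) (n : nat) (lam : 'rV[R]_n) : {set 'I_n} :=
  finset (fun k : 'I_n => 0 < lam 0 k).

Definition pos_factor (R : realType) (n : nat) (V : 'M[R]_n) (lam : 'rV[R]_n) :
  'M[R]_(#|pos_idx lam|, n) :=
  \matrix_(r, j) (Num.sqrt (lam 0 (enum_val r)) * V j (enum_val r)).

Definition neg_factor (R : realType) (n : nat) (V : 'M[R]_n) (lam : 'rV[R]_n) :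
  'M[R]_(#|pos_idx (- lam)|, n) := pos_factor V (- lam).

(* The fixed factorizations: Q_i = B_i^T B_i on convex indices, and a spectral
   decomposition (V_i, lam_i) of Q_i on nonconvex ones.  Entries at the other
   indices are never used. *)
Record factors (R : realType) (n l : nat) := Factors {
  facB : 'I_l -> 'M[R]_n;
  facV : 'I_l -> 'M[R]_n;
  faclam : 'I_l -> 'rV[R]_n
}.

Definition factors_of (R : realType) (n l m : nat) (P : qcqp R n l m)
  (D : factors R n l) : Prop :=
  (forall i, i \in cvx_idx P -> Q P i = (facB D i)^T *m facB D i) /\
  (forall i, i \in ncvx_idx P ->
     spectral_decomposition (Q P i) (facV D i) (faclam D i)).

Definition facL (R : realType) (n l : nat) (D : factors R n l) (i : 'I_l) :=
  pos_factor (facV D i) (faclam D i).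

Definition facM (R : realType) (n l : nat) (D : factors R n l) (i : 'I_l) :=
  neg_factor (facV D i) (faclam D i).

Definition linear_cons (R : realType) (n l m : nat) (P : qcqp R n l m)
  (x : 'cV[R]_n) : Prop :=
  forall j, dotv (a P j) x <= b P j.

Definition P_feasible (R : realType) (n l m : nat) (P : qcqp R n l m)
  (x : 'cV[R]_n) : Prop :=
  (forall i, dotv x (Q P i *m x) + dotv (c P i) x + d P i <= 0) /\
  linear_cons P x.

Definition val_P (R : realType) (n l m : nat) (P : qcqp R n l m) : \bar R :=
  optval [set x | P_feasible P x]%classic
         (fun x => dotv x (Q0 P *m x) + dotv (c0 P) x).

Definition lifted_quad (R : realType) (n l m : nat) (P : qcqp R n l m)
  (x : 'cV[R]_n) (X : 'M[R]_n) : Prop :=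
  forall i, dotm (Q P i) X + dotv (c P i) x + d P i <= 0.

Definition lifted_psd (R : realType) (n : nat)
  (x : 'cV[R]_n) (X : 'M[R]_n) : Prop :=
  psd (block_mx (1%:M : 'M[R]_1) x^T x X).

Definition rlt_cons (R : realType) (n l m : nat) (P : qcqp R n l m)
  (x : 'cV[R]_n) (X : 'M[R]_n) : Prop :=
  forall i j : 'I_m, (i < j)%N ->
    0 <= dotm (a P i *m (a P j)^T) X + b P i * b P j
         - b P j * dotv (a P i) x - b P i * dotv (a P j) x.

Definition soc_rlt_cons (R : realType) (n l m : nat) (P : qcqp R n l m)
  (D : factors R n l) (x : 'cV[R]_n) (X : 'M[R]_n) : Prop :=
  forall i, i \in cvx_idx P -> forall j : 'I_m,
    norm2_app
      (facB D i *m (b P j *: x - X *m a P j))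
      (2^-1 * (- dotv (c P i) (X *m a P j)
               + dotv (b P j *: c P i - d P i *: a P j - a P j) x
               + (1 + d P i) * b P j))
    <= 2^-1 * (dotv (c P i) (X *m a P j)
               + dotv (d P i *: a P j - a P j - b P j *: c P i) x
               + (1 - d P i) * b P j).

Definition gsrt_cons (R : realType) (n l m : nat) (P : qcqp R n l m)
  (D : factors R n l) (x : 'cV[R]_n) (X : 'M[R]_n)
  (z : 'cV[R]_#|ncvx_idx P|) (S : 'M[R]_(n, #|ncvx_idx P|))
  (Z : 'M[R]_#|ncvx_idx P|) : Prop :=
  forall r : 'I_#|ncvx_idx P|, let i := enum_val r in
  [/\ norm2_app (facL D i *m x) (2^-1 * (dotv (c P i) x + d P i + 1)) <= z r 0,
      norm2_app (facM D i *m x) (2^-1 * (dotv (c P i) x + d P i - 1)) <= z r 0,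
      (forall j : 'I_m,
         norm2_app
           (facL D i *m (b P j *: x - X *m a P j))
           (2^-1 * (dotv (c P i) (b P j *: x - X *m a P j)
                    + (d P i + 1) * (b P j - dotv (a P j) x)))
         <= z r 0 * b P j - dotv (col r S) (a P j)),
      (forall j : 'I_m,
         norm2_app
           (facM D i *m (b P j *: x - X *m a P j))
           (2^-1 * (dotv (c P i) (b P j *: x - X *m a P j)
                    + (d P i - 1) * (b P j - dotv (a P j) x)))
         <= z r 0 * b P j - dotv (col r S) (a P j)) &
      Z r r = dotm X ((facM D i)^T *m facM D i)
              + 4^-1 * (dotm (c P i *m (c P i)^T) X + (d P i - 1) ^+ 2
                        + 2 * (d P i - 1) * dotv (c P i) x)].

Definition gsrt_psd (R : realType) (n p : nat) (x : 'cV[R]_n) (X : 'M[R]_n)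
  (z : 'cV[R]_p) (S : 'M[R]_(n, p)) (Z : 'M[R]_p) : Prop :=
  psd (block_mx (block_mx (1%:M : 'M[R]_1) x^T x X) (col_mx z^T S)
                (row_mx z S^T) Z).

Definition lifted_obj (R : realType) (n l m : nat) (P : qcqp R n l m)
  (x : 'cV[R]_n) (X : 'M[R]_n) : R :=
  dotm (Q0 P) X + dotv (c0 P) x.

Definition val_SDP (R : realType) (n l m : nat) (P : qcqp R n l m) : \bar R :=
  optval
    [set t : 'cV[R]_n * 'M[R]_n | let: (x, X) := t in
      [/\ X^T = X, lifted_quad P x X, linear_cons P x & lifted_psd x X]]%classic
    (fun t => lifted_obj P t.1 t.2).

Definition val_SDP_RLT (R : realType) (n l m : nat) (P : qcqp R n l m) :
  \bar R :=
  optval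
    [set t : 'cV[R]_n * 'M[R]_n | let: (x, X) := t in
      [/\ X^T = X, lifted_quad P x X, linear_cons P x, lifted_psd x X &
          rlt_cons P x X]]%classic
    (fun t => lifted_obj P t.1 t.2).

Definition val_SDP_SOC_RLT (R : realType) (n l m : nat) (P : qcqp R n l m)
  (D : factors R n l) : \bar R :=
  optval
    [set t : 'cV[R]_n * 'M[R]_n | let: (x, X) := t in
      [/\ X^T = X, lifted_quad P x X, linear_cons P x & lifted_psd x X] /\
      [/\ rlt_cons P x X & soc_rlt_cons P D x X]]%classic
    (fun t => lifted_obj P t.1 t.2).

Definition val_SDP_GSRT_A (R : realType) (n l m : nat) (P : qcqp R n l m)
  (D : factors R n l) : \bar R :=
  optval
    [set t : 'cV[R]_n * 'M[R]_n * 'cV[R]_#|ncvx_idx P|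
             * 'M[R]_(n, #|ncvx_idx P|) * 'M[R]_#|ncvx_idx P| |
      let: (x, X, z, S', Z) := t in
      [/\ X^T = X, lifted_quad P x X, linear_cons P x & rlt_cons P x X] /\
      [/\ Z^T = Z, soc_rlt_cons P D x X, gsrt_cons D x X z S' Z &
          gsrt_psd x X z S' Z]]%classic
    (fun t => let: (x, X, z, S', Z) := t in lifted_obj P x X).

(* Main.v *)
Require Import Defs.
From mathcomp Require Import all_boot all_order all_algebra.
From mathcomp Require Import all_classical all_reals ereal.
From mathcomp Require Import ring lra.
Set Implicit Arguments.
Unset Strict Implicit.
Unset Printing Implicit Defensive.

Import Order.TTheory GRing.Theory Num.Theory.
Local Open Scope ring_scope.

(** Every inequality compares two infima, so it is enough to send each feasible
    point of one problem to a feasible point of its relaxation with the same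
    objective value.

    Among the four relaxations this map forgets variables or constraints.  The
    only point to check is that the semidefinite constraint on [(x, X, z, S, Z)]
    implies the one on [(x, X)], whose matrix is a principal block.

    A feasible point [x] of the original problem is lifted to
    [X = x x^T, S = x z^T, Z = z z^T], where
    [z_i = |(M_i x, (c_i^T x + d_i - 1) / 2)|] is the value forced by the
    equation on [Z_ii].  The big matrix is then the Gram matrix of [(1, x, z)].
    Write [s = c_i^T x + d_i] and let [y] be the slack [b_j - a_j^T x >= 0].
    - Since [(s + 1)^2 / 4 - (s - 1)^2 / 4 = s], the quadratic constraint
      [|L_i x|^2 - |M_i x|^2 + s <= 0] is the cone constraint
      [|(L_i x, (s + 1) / 2)| <= |(M_i x, (s - 1) / 2)|] ([soc_of_quad]).  In
      the convex case [M_i] is absent and [s <= 0], so the right-hand side is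
      [(1 - s) / 2] ([soc_of_cvx_quad]).
    - At [X = x x^T] the product constraints factor: [b_j x - X a_j = y x], so
      both sides of the cone constraint are multiplied by [y] ([norm2_appZ]),
      which preserves it.  An RLT constraint says that a product of two slacks
      is nonnegative. *)

(** * Bilinear forms and rank-one matrices *)

Section BilinearForms.
Variable R : realType.

Lemma dotvE n (u v : 'cV[R]_n) : dotv u v = (u^T *m v) 0 0.
Proof. by rewrite /dotv mxE; apply: eq_bigr => i _; rewrite mxE. Qed.

Lemma dotvC n (u v : 'cV[R]_n) : dotv u v = dotv v u.
Proof. by rewrite /dotv; apply: eq_bigr => i _; rewrite mulrC. Qed.

Lemma dotvZr n t (u v : 'cV[R]_n) : dotv u (t *: v) = t * dotv u v.
Proof. by rewrite !dotvE -scalemxAr mxE. Qed.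

Lemma dotvZl n t (u v : 'cV[R]_n) : dotv (t *: u) v = t * dotv u v.
Proof. by rewrite dotvC dotvZr dotvC. Qed.

Lemma dotvBl n (u u' v : 'cV[R]_n) : dotv (u - u') v = dotv u v - dotv u' v.
Proof. by rewrite !dotvE linearB /= mulmxBl !mxE. Qed.

Lemma dotvv_ge0 n (u : 'cV[R]_n) : 0 <= dotv u u.
Proof. by apply: sumr_ge0 => i _; rewrite -expr2 sqr_ge0. Qed.

Lemma dotv_mulmxr n p (A : 'M[R]_(p, n)) (u : 'cV[R]_p) (v : 'cV[R]_n) :
  dotv u (A *m v) = dotv (A^T *m u) v.
Proof. by rewrite !dotvE trmx_mul trmxK mulmxA. Qed.

Lemma dotv_col_mx n p (u v : 'cV[R]_n) (u' v' : 'cV[R]_p) :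
  dotv (col_mx u u') (col_mx v v') = dotv u v + dotv u' v'.
Proof. by rewrite !dotvE tr_col_mx mul_row_col mxE. Qed.

Lemma dotmC n (A B : 'M[R]_n) : dotm A B = dotm B A.
Proof.
by apply: eq_bigr => i _; apply: eq_bigr => j _; rewrite mulrC.
Qed.

Lemma rank1_mul n p (u : 'cV[R]_n) (v w : 'cV[R]_p) :
  u *m v^T *m w = dotv v w *: u.
Proof. by rewrite -mulmxA [v^T *m w]mx11_scalar mul_mx_scalar dotvE. Qed.

Lemma dotm_rank1 n (A : 'M[R]_n) (u v : 'cV[R]_n) :
  dotm A (u *m v^T) = dotv u (A *m v).
Proof.
apply: eq_bigr => i _; rewrite mxE mulr_sumr; apply: eq_bigr => j _.
by rewrite mxE big_ord1 mxE; ring.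
Qed.

Lemma psd_rank1 n (v : 'cV[R]_n) : psd (v *m v^T).
Proof.
split=> [|u]; first by rewrite trmx_mul trmxK.
by rewrite rank1_mul dotvZr (dotvC u) -expr2 sqr_ge0.
Qed.

(** This is how the semidefinite constraint on [(x, X, z, S, Z)] yields the one
    on [(x, X)]; test vectors are extended by zero. *)
Lemma psd_ulblock n p (A : 'M[R]_n) (B : 'M[R]_(n, p)) C (E : 'M[R]_p) :
  psd (block_mx A B C E) -> psd A.
Proof.
case; rewrite tr_block_mx => /eq_block_mx[Asym _ _ _] pos; split=> // u.
have := pos (col_mx u 0).
by rewrite mul_block_col !mulmx0 !addr0 dotv_col_mx [dotv 0 _]dotvE trmx0
           mul0mx mxE addr0.
Qed.

End BilinearForms.

(** * Second-order cone constraints *)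

Section SecondOrderCone.
Variable R : realType.

Lemma norm2_appE n (u : 'cV[R]_n) s :
  norm2_app u s = Num.sqrt (dotv u u + s ^+ 2).
Proof.
rewrite /norm2_app /norm2; congr Num.sqrt.
transitivity (dotv (col_mx u (s%:M : 'cV_1)) (col_mx u (s%:M : 'cV_1))).
  by apply: eq_bigr => i _; rewrite expr2.
by rewrite dotv_col_mx; congr (_ + _); rewrite /dotv big_ord1 mxE eqxx mulr1n.
Qed.

Lemma sqr_norm2_app n (u : 'cV[R]_n) s :
  norm2_app u s ^+ 2 = dotv u u + s ^+ 2.
Proof. by rewrite norm2_appE sqr_sqrtr // addr_ge0 ?dotvv_ge0 ?sqr_ge0. Qed.

Lemma norm2_app_ge0 n (u : 'cV[R]_n) s : 0 <= norm2_app u s.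
Proof. by rewrite norm2_appE sqrtr_ge0. Qed.

Lemma norm2_app_le n (u : 'cV[R]_n) s t :
  0 <= t -> dotv u u + s ^+ 2 <= t ^+ 2 -> norm2_app u s <= t.
Proof.
by move=> t0 h; rewrite -ler_sqr ?nnegrE ?norm2_app_ge0 // sqr_norm2_app.
Qed.

Lemma norm2_appZ n (u : 'cV[R]_n) s t :
  0 <= t -> norm2_app (t *: u) (t * s) = t * norm2_app u s.
Proof.
move=> t0; rewrite !norm2_appE dotvZl dotvZr mulrA exprMn -expr2 -mulrDr.
by rewrite sqrtrM ?sqr_ge0 // sqrtr_sqr ger0_norm.
Qed.

(** A sign condition on a difference of squares becomes a cone constraint by
    writing [s = (s + 1)^2 / 4 - (s - 1)^2 / 4]. *)
Lemma soc_of_quad n p (u : 'cV[R]_n) (v : 'cV[R]_p) s :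
  dotv u u - dotv v v + s <= 0 ->
  norm2_app u (2^-1 * (s + 1)) <= norm2_app v (2^-1 * (s - 1)).
Proof.
move=> h; apply: norm2_app_le; first exact: norm2_app_ge0.
rewrite sqr_norm2_app; nra.
Qed.

Lemma soc_of_cvx_quad n (u : 'cV[R]_n) s :
  dotv u u + s <= 0 -> norm2_app u (2^-1 * (s + 1)) <= 2^-1 * (1 - s).
Proof. by move=> h; have := dotvv_ge0 u => u0; apply: norm2_app_le; nra. Qed.

End SecondOrderCone.

(** * The spectral splitting of a quadratic form *)

Section SpectralSplitting.
Variable R : realType.

Lemma pos_factor_quad n (V : 'M[R]_n) (lam : 'rV[R]_n) (x : 'cV[R]_n) :
  dotv (pos_factor V lam *m x) (pos_factor V lam *m x) =
  \sum_(k | 0 < lam 0 k) lam 0 k * (V^T *m x) k 0 ^+ 2.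
Proof.
rewrite (eq_bigl [in pos_idx lam]); last by move=> k; rewrite inE.
rewrite big_enum_val; apply: eq_bigr => r _.
have -> : (pos_factor V lam *m x) r 0 =
    Num.sqrt (lam 0 (enum_val r)) * (V^T *m x) (enum_val r) 0.
  rewrite !mxE mulr_sumr; apply: eq_bigr => j _.
  by rewrite !mxE mulrA.
rewrite -expr2 exprMn sqr_sqrtr //.
by have := enum_valP r; rewrite inE => /ltW.
Qed.

Lemma spectral_quad n (A V : 'M[R]_n) (lam : 'rV[R]_n) (x : 'cV[R]_n) :
  spectral_decomposition A V lam ->
  dotv x (A *m x) = \sum_k lam 0 k * (V^T *m x) k 0 ^+ 2.
Proof.
case=> _ ->; rewrite -!mulmxA dotv_mulmxr; apply: eq_bigr => k _.
by rewrite mul_diag_mx [X in _ * X = _]mxE; ring.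
Qed.

(** The form is diagonal in the eigenbasis, and each eigenvalue contributes to
    the positive factor, to the negative factor, or is zero. *)
Lemma quad_pos_neg n (A V : 'M[R]_n) (lam : 'rV[R]_n) (x : 'cV[R]_n) :
  spectral_decomposition A V lam ->
  dotv x (A *m x) = dotv (pos_factor V lam *m x) (pos_factor V lam *m x)
                  - dotv (neg_factor V lam *m x) (neg_factor V lam *m x).
Proof.
move=> /spectral_quad ->; rewrite /neg_factor !pos_factor_quad.
rewrite [X in X - _]big_mkcond [X in _ - X]big_mkcond -sumrB.
apply: eq_bigr => k _; rewrite [(- lam) _ _]mxE oppr_gt0.
case: ltgtP => [_|_|<-]; ring.
Qed.

End SpectralSplitting.

(** * Comparison of the optimal values *)

Section Comparison.
Variables (R : realType) (n l m : nat).
Implicit Types (P : qcqp R n l m) (D : factors R n l) (x : 'cV[R]_n).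

Lemma le_optval (T U : Type) (F : set T) (f : T -> R) (G : set U) (g : U -> R)
    (h : T -> U) :
  (forall t, F t -> G (h t) /\ g (h t) = f t) -> (optval G g <= optval F f)%E.
Proof.
move=> hFG; apply: ereal_inf_le_tmp => _ [t Ft <-].
by have [Gt <-] := hFG t Ft; exists (h t).
Qed.

(** The value that the equation on the diagonal of [Z] forces when
    [X = x x^T] and [Z = z z^T]. *)
Definition lift_z P D x : 'cV[R]_#|ncvx_idx P| :=
  \col_r let i := enum_val r in
    norm2_app (facM D i *m x) (2^-1 * (dotv (c P i) x + d P i - 1)).

Lemma rank1_soc_rlt P D x :
  factors_of P D -> P_feasible P x -> soc_rlt_cons P D x (x *m x^T).
Proof.
move=> [hB _] [hq hl] i iC j; rewrite rank1_mul (dotvC x) dotvZr.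
rewrite -scalerBl -scalemxAr !dotvBl !dotvZl.
set y := b P j - dotv (a P j) x; set s := dotv (c P i) x + d P i.
have y0 : 0 <= y by rewrite subr_ge0.
rewrite [X in norm2_app _ X](_ : _ = y * (2^-1 * (s + 1))); last first.
  by rewrite /y /s; ring.
rewrite [leRHS](_ : _ = y * (2^-1 * (1 - s))); last by rewrite /y /s; ring.
rewrite norm2_appZ // ler_wpM2l //; apply: soc_of_cvx_quad.
have := hq i; rewrite (hB i iC) -mulmxA dotv_mulmxr trmxK.
by rewrite -addrA.
Qed.

Lemma rank1_gsrt P D x (z := lift_z P D x) :
  factors_of P D -> P_feasible P x ->
  gsrt_cons D x (x *m x^T) z (x *m z^T) (z *m z^T).
Proof.
move=> [_ hV] [hq hl] r i.
have iN : i \in ncvx_idx P by exact: enum_valP.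
have zE : z r 0 = norm2_app (facM D i *m x)
                   (2^-1 * (dotv (c P i) x + d P i - 1)) by rewrite mxE.
have Lz : norm2_app (facL D i *m x) (2^-1 * (dotv (c P i) x + d P i + 1))
          <= z r 0.
  rewrite zE; apply: soc_of_quad.
  by rewrite -(quad_pos_neg _ (hV i iN)) addrA.
have slack j : 0 <= b P j - dotv (a P j) x by rewrite subr_ge0.
have xE j : b P j *: x - x *m x^T *m a P j = (b P j - dotv (a P j) x) *: x.
  by rewrite rank1_mul (dotvC x) scalerBl.
have SE j : z r 0 * b P j - dotv (col r (x *m z^T)) (a P j) =
            (b P j - dotv (a P j) x) * z r 0.
  have -> : col r (x *m z^T) = z r 0 *: x.
    by apply/colP => k; rewrite !mxE big_ord1 !mxE mulrC.
  by rewrite dotvZl (dotvC x); ring.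
split=> //; first by rewrite zE.
- move=> j; rewrite xE SE -scalemxAr dotvZr.
  rewrite [X in norm2_app _ X](_ : _ = (b P j - dotv (a P j) x) *
    (2^-1 * (dotv (c P i) x + d P i + 1))); last by ring.
  by rewrite norm2_appZ // ler_wpM2l.
- move=> j; rewrite xE SE -scalemxAr dotvZr.
  rewrite [X in norm2_app _ X](_ : _ = (b P j - dotv (a P j) x) *
    (2^-1 * (dotv (c P i) x + d P i - 1))); last by ring.
  by rewrite norm2_appZ // ler_wpM2l // zE.
- rewrite mxE big_ord1 [z^T _ _]mxE -expr2 zE sqr_norm2_app.
  rewrite (dotmC (x *m x^T)) !dotm_rank1 rank1_mul dotvZr (dotvC x (c P i)).
  rewrite -mulmxA (dotv_mulmxr (facM D i)^T) trmxK.
  by field.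
Qed.

Lemma rank1_rlt P x : linear_cons P x -> rlt_cons P x (x *m x^T).
Proof.
move=> hl i j _; rewrite dotm_rank1 rank1_mul dotvZr (dotvC x).
have hi := hl i; have hj := hl j; nra.
Qed.

Lemma rank1_gsrt_psd p x (z : 'cV[R]_p) :
  gsrt_psd x (x *m x^T) z (x *m z^T) (z *m z^T).
Proof.
rewrite /gsrt_psd; have := psd_rank1 (col_mx (col_mx (1%:M : 'M_1) x) z).
rewrite !tr_col_mx !mul_col_row mul_col_mx mul_mx_row trmx1 mul1mx mulmx1.
by rewrite !mul1mx mulmx1 (trmx_mul x) trmxK.
Qed.

Lemma val_GSRT_A_le_P P D :
  factors_of P D -> (val_SDP_GSRT_A P D <= val_P P)%E.
Proof.
move=> hD.
pose z x := lift_z P D x.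
apply: (@le_optval _ _ _ _ _ _
  (fun x => (x, x *m x^T, z x, x *m (z x)^T, z x *m (z x)^T))) => x hx /=.
have [hq hl] := hx.
split; last by rewrite /lifted_obj dotm_rank1.
split; split.
- by rewrite trmx_mul trmxK.
- by move=> i; rewrite dotm_rank1.
- exact: hl.
- exact: rank1_rlt.
- by rewrite trmx_mul trmxK.
- exact: rank1_soc_rlt.
- exact: rank1_gsrt.
- exact: rank1_gsrt_psd.
Qed.

Lemma val_SOC_RLT_le_GSRT_A P D :
  (val_SDP_SOC_RLT P D <= val_SDP_GSRT_A P D)%E.
Proof.
apply: (@le_optval _ _ _ _ _ _ (fun t => t.1.1.1)) => -[[[[x X] z] S] Z] /=.
by case=> -[Xsym hq hl hr] [_ hs _ /psd_ulblock hp].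
Qed.

Lemma val_RLT_le_SOC_RLT P D : (val_SDP_RLT P <= val_SDP_SOC_RLT P D)%E.
Proof.
by apply: (@le_optval _ _ _ _ _ _ id) => -[x X] /= [[? ? ? ?] [? _]].
Qed.

Lemma val_SDP_le_RLT P : (val_SDP P <= val_SDP_RLT P)%E.
Proof. by apply: (@le_optval _ _ _ _ _ _ id) => -[x X] /= [? ? ? ? _]. Qed.

End Comparison.

Theorem theorem2p2 (R : realType) (n l m : nat) (P : qcqp R n l m)
  (D : factors R n l)
  (hQ0 : (Q0 P)^T = Q0 P)
  (hQ : forall i : 'I_l, (Q P i)^T = Q P i)
  (hQ_neq0 : forall i : 'I_l, Q P i <> 0)
  (hD : factors_of P D) :
  [/\ (val_P P >= val_SDP_GSRT_A P D)%E,
      (val_SDP_GSRT_A P D >= val_SDP_SOC_RLT P D)%E,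
      (val_SDP_SOC_RLT P D >= val_SDP_RLT P)%E &
      (val_SDP_RLT P >= val_SDP P)%E].
Proof.
split; first exact: val_GSRT_A_le_P.
- exact: val_SOC_RLT_le_GSRT_A.
- exact: val_RLT_le_SOC_RLT.
- exact: val_SDP_le_RLT.
Qed.
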